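(* Let $p$ be an odd prime and let $(E'/E)(x)=\sum_{n\ge0}x^{p^n-1}$, $|x|_p<1$, be the logarithmic derivative of the Artin–Hasse exponential function $E$. Then $$\int_{\mathcal{A}(1,0),k}(E'/E)(x)\,dx \equiv -1 \pmod{p^{3}},$$ where the integral is with respect to the path sequence $\varphi(k)=k$ (and exists).
   Context: $\mathbb{C}_p$ is the completion of an algebraic closure of $\mathbb{Q}_p$, with $|p|_p=1/p$. $\mathcal{A}(1,0)$ is the open disc $\{x\in\mathbb{C}_p:|x|_p<1\}$, regarded as the arc at $b=0$ of the circle with center $a=1$ and radius $1$. For $f:\mathcal{A}(a,b)\to\mathbb{C}_p$, the integral with respect to $\varphi(k)=k$ is $$\int_{\mathcal{A}(a,b),k}f(x)\,dx=\lim_{k\to\infty}p^{-k}\sum_{\zeta^{p^k}=1}(x-a)f(x),\qquad x=a+(b-a)\zeta,$$ if the limit exists. $L\equiv -1\pmod{p^3}$ means $|L+1|_p\le p^{-3}$. *)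

(* Defs.v *)
From mathcomp Require Import all_boot all_order all_algebra.
From mathcomp Require Import all_classical all_reals all_analysis.
Set Implicit Arguments.
Unset Strict Implicit.
Unset Printing Implicit Defensive.
Import Order.TTheory GRing.Theory Num.Theory.
Import numFieldNormedType.Exports.
Local Open Scope classical_set_scope.
Local Open Scope ring_scope.

(* The p-adic absolute value is an explicit real-valued function: a
   [normedZmodType] would require |x *+ n| = |x| *+ n, which is false here. *)
Record nonarch_abs (R : realType) (F : fieldType) (v : F -> R) : Prop :=
  NonarchAbs {
    nabs_ge0 : forall x, 0 <= v x;
    nabs_eq0 : forall x, v x = 0 <-> x = 0;
    nabsM : forall x y, v (x * y) = v x * v y;
    nabsD : forall x y, v (x + y) <= Num.max (v x) (v y) }.

Section ValuedField.
Variables (R : realType) (F : fieldType) (v : F -> R).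

Definition abs_cvg (u : nat -> F) (l : F) : Prop :=
  v (u n - l) @[n --> \oo] --> (0 : R).

Definition abs_cauchy (u : nat -> F) : Prop :=
  forall e : R, 0 < e ->
    exists N : nat, forall m n : nat, (N <= m)%N -> (N <= n)%N ->
      v (u m - u n) < e.

Definition abs_complete : Prop :=
  forall u : nat -> F, abs_cauchy u -> exists l, abs_cvg u l.

(* Junk value 0 when there is no limit, resp. no derivative. *)
Definition abs_lim (u : nat -> F) : F := xget 0 [set l | abs_cvg u l].

Definition abs_is_derive (f : F -> F) (x l : F) : Prop :=
  forall e : R, 0 < e ->
    exists2 d : R, 0 < d &
      forall h : F, h != 0 -> v h < d -> v ((f (x + h) - f x) / h - l) < e.

Definition abs_derive (f : F -> F) (x : F) : F :=
  xget 0 [set l | abs_is_derive f x l].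

Definition log_derive (f : F -> F) (x : F) : F := abs_derive f x / f x.

(* The n-th term p^{-n} \sum_{zeta^{p^n} = 1} (x - a) f x, where
   x = a + (b - a) zeta. As |zeta - 1| < 1, every such x lies in the open disc
   of center b and radius |b - a|, so the values of f elsewhere are
   irrelevant. *)
Definition arc_sum (p : nat) (a b : F) (f : F -> F) (n : nat) : F :=
  ((p ^ n)%:R)^-1 *
  \sum_(z \in [set z : F | z ^+ (p ^ n) = 1])
     (let x := a + (b - a) * z in (x - a) * f x).

Definition is_arc_integral (p : nat) (a b : F) (f : F -> F) (l : F) : Prop :=
  abs_cvg (arc_sum p a b f) l.

End ValuedField.

Record is_completion (R : realType) (K F : fieldType) (vK : K -> R)
    (vF : F -> R) (i : {rmorphism K -> F}) : Prop := IsCompletion {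
  completion_abs : nonarch_abs vF;
  completion_ext : forall x, vF (i x) = vK x;
  completion_complete : abs_complete vF;
  completion_dense : forall (y : F) (e : R), 0 < e -> exists x, vF (y - i x) < e
}.

Record is_algebraic_closure (K F : fieldType) (i : {rmorphism K -> F}) : Prop :=
  IsAlgebraicClosure {
    algclosure_closed : GRing.closed_field_axiom F;
    algclosure_algebraic : forall x : F, algebraicOver i x }.

Definition padic_abs (R : realType) (p : nat) (x : rat) : R :=
  if x == 0 then 0
  else p%:R ^+ logn p `|denq x|%N / p%:R ^+ logn p `|numq x|%N.

(* C_p up to isometric isomorphism: a tower Q -> Q_p -> Qbar_p -> C_p in which
   each field is determined by the previous one (the extension of the absolute
   value of Q_p to its algebraic closure being unique). *)
Structure Cp (R : realType) (p : nat) := MkCp {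
  Qp : fieldType;
  Qp_abs : Qp -> R;
  Qp_of_rat : {rmorphism rat -> Qp};
  Qp_completion : is_completion (@padic_abs R p) Qp_abs Qp_of_rat;
  Qpbar : fieldType;
  Qpbar_abs : Qpbar -> R;
  Qpbar_of_Qp : {rmorphism Qp -> Qpbar};
  Qpbar_closure : is_algebraic_closure Qpbar_of_Qp;
  Qpbar_nonarch : nonarch_abs Qpbar_abs;
  Qpbar_ext : forall x, Qpbar_abs (Qpbar_of_Qp x) = Qp_abs x;
  Cp_sort :> fieldType;
  Cp_abs : Cp_sort -> R;
  Cp_of_Qpbar : {rmorphism Qpbar -> Cp_sort};
  Cp_completion : is_completion Qpbar_abs Cp_abs Cp_of_Qpbar }.

(* \sum_j X^(p^j) / p^j, up to degree at least n when p > 1. *)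
Definition artin_hasse_log (p n : nat) : {poly rat} :=
  \sum_(j < n.+1) ((p ^ j)%:R)^-1 *: 'X^(p ^ j).

(* The coefficient of X^n in exp (\sum_j X^(p^j) / p^j). The inner series has
   no constant term, so the truncations at n do not affect it. *)
Definition artin_hasse_coef (p n : nat) : rat :=
  (\sum_(k < n.+1) (k`!%:R)^-1 *: artin_hasse_log p n ^+ k)`_n.

Definition artin_hasse (R : realType) (p : nat) (C : Cp R p) (x : C) : C :=
  abs_lim (@Cp_abs R p C)
    (series (fun n => ratr (artin_hasse_coef p n) * x ^+ n)).

(* Main.v *)
Require Import Defs.
From HB Require Import structures.
From mathcomp Require Import all_boot all_order all_algebra.
From mathcomp Require Import all_classical all_reals all_analysis.
From mathcomp Require Import ring zify.
Set Implicit Arguments.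
Unset Strict Implicit.
Unset Printing Implicit Defensive.
Import Order.TTheory GRing.Theory Num.Theory.
Import numFieldNormedType.Exports.
Local Open Scope classical_set_scope.
Local Open Scope ring_scope.

(* Dwork's argument gives the p-integrality of the coefficients of E: the
   series E(X)^p and E(X^p) exp(pX) solve the same equation
   y' = p (E'/E) y, hence coincide, and exp(pX) = 1 mod p. So E converges and
   has absolute value 1 on the open unit disc, where it satisfies
   E' = (\sum_j x^(p^j-1)) E.

   Filtering the binomial expansion of (1-z)^(p^j-1) by p^n-th roots of unity,
   the n-th arc sum is - \sum_j T(n,j) with
     T(n,j) = \sum_(1 <= l <= p^j, p^n | l) (-1)^(l-1) C(p^j-1, l-1).
   Here T(n,j) = 0 for j < n, T(n,n) = 1, and the congruence
     C(p^(j+1)-1, pl-1) = C(p^j-1, l-1)  mod p^(j+2)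
   yields T(n+1,j+1) = T(n,j) mod p^(j+2). Hence consecutive arc sums agree
   modulo p^(n+3), and the 0-th one is -1. *)

(** * Nonarchimedean absolute values *)

Section Nonarch.
Variables (R : realType) (F : fieldType) (v : F -> R).
Hypothesis vP : nonarch_abs v.

Lemma nabs0 : v 0 = 0.
Proof. by have [_ ->] := nabs_eq0 vP 0. Qed.

Lemma nabs_neq0 x : (v x == 0) = (x == 0).
Proof. by apply/eqP/eqP => /(nabs_eq0 vP). Qed.

Lemma nabs1 : v 1 = 1.
Proof.
have /eqP := nabsM vP 1 1; rewrite mulr1 -subr_eq0 -{1}[v 1]mulr1 -mulrBr.
by rewrite mulf_eq0 nabs_neq0 oner_eq0 /= subr_eq0 => /eqP.
Qed.

Lemma nabsX x n : v (x ^+ n) = v x ^+ n.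
Proof. by elim: n => [|n IH]; rewrite ?expr0 ?nabs1 // !exprS nabsM// IH. Qed.

Lemma nabsN x : v (- x) = v x.
Proof.
have h : v (-1) = 1.
  apply/eqP; rewrite -(@eqrXn2 _ 2) ?(nabs_ge0 vP)// expr1n -nabsX.
  by rewrite sqrrN expr1n nabs1.
by rewrite -mulN1r nabsM// h mul1r.
Qed.

Lemma nabsC x y : v (x - y) = v (y - x).
Proof. by rewrite -nabsN opprB. Qed.

Lemma nabsD_le x y M : v x <= M -> v y <= M -> v (x + y) <= M.
Proof. by move=> hx hy; rewrite (le_trans (nabsD vP x y))// ge_max hx. Qed.

Lemma nabsD_lt x y M : v x < M -> v y < M -> v (x + y) < M.
Proof. by move=> hx hy; rewrite (le_lt_trans (nabsD vP x y))// gt_max hx. Qed.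

Lemma nabsB_le x y M : v x <= M -> v y <= M -> v (x - y) <= M.
Proof. by move=> hx hy; rewrite nabsD_le ?nabsN. Qed.

Lemma nabs_dist_lt y x z M : v (x - y) < M -> v (y - z) < M -> v (x - z) < M.
Proof. by move=> h h'; rewrite -(subrK y x) -addrA nabsD_lt. Qed.

Lemma nabs_sum_le (I : Type) (r : seq I) (P : pred I) (E : I -> F) M :
  0 <= M -> (forall i, P i -> v (E i) <= M) -> v (\sum_(i <- r | P i) E i) <= M.
Proof.
by move=> M0 h; elim/big_rec: _ => [|i x Pi]; [rewrite nabs0|apply: nabsD_le; exact: h].
Qed.

Lemma nabsV x : v x^-1 = (v x)^-1.
Proof.
have [->|x0] := eqVneq x 0; first by rewrite invr0 nabs0 invr0.
apply: (@mulfI _ (v x)); rewrite ?nabs_neq0// -nabsM// !divff ?nabs1//.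
by rewrite nabs_neq0.
Qed.

Lemma nabs_nat n : v n%:R <= 1.
Proof. by elim: n => [|n IH]; rewrite ?nabs0// -natr1 nabsD_le// nabs1. Qed.

Lemma nabs_int (z : int) : v z%:~R <= 1.
Proof. by case: z => n; rewrite ?NegzE ?mulrNz ?nabsN nabs_nat. Qed.

Lemma nabs_dvdz (p : nat) (z : int) e : (Posz (p ^ e) %| z)%Z ->
  v z%:~R <= v p%:R ^+ e.
Proof.
move=> /dvdzP[q ->]; rewrite intrM nabsM// -pmulrn natrX nabsX.
by rewrite ler_piMl ?exprn_ge0 ?(nabs_ge0 vP)// nabs_int.
Qed.

(** Otherwise a Bézout relation between [m] and [p] would write 1 as a difference of two elements of
    absolute value less than 1. *)
Lemma nabs_coprime (p m : nat) : v p%:R < 1 -> coprime m p -> v m%:R = 1.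
Proof.
move=> hp cop; apply/eqP; rewrite eq_le nabs_nat leNgt; apply/negP => hm.
have m0 : (0 < m)%N.
  rewrite lt0n; apply/eqP => m0; move: cop; rewrite m0 /coprime gcd0n => /eqP p1.
  by move: hp; rewrite p1 nabs1 ltxx.
have [km kn e _] := egcdnP p m0.
have : v (1 : F) < 1.
  have -> : (1 : F) = (km * m)%:R - (kn * p)%:R.
    by rewrite e (eqP cop) natrD addrC addKr.
  rewrite !natrM; apply: nabsD_lt; rewrite ?nabsN nabsM//.
    by rewrite (le_lt_trans _ hm)// ler_piMl ?nabs_nat ?(nabs_ge0 vP).
  by rewrite (le_lt_trans _ hp)// ler_piMl ?nabs_nat ?(nabs_ge0 vP).
by rewrite nabs1 ltxx.
Qed.

(* Carrying the proof [vP] lets [vint vP] be a canonical subring. *)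
Definition vint of nonarch_abs v : {pred F} := fun x => v x <= 1.

Lemma vintE x : (x \in vint vP) = (v x <= 1). Proof. by []. Qed.

Lemma vint_subring : subring_closed (vint vP).
Proof.
split=> [|x y hx hy|x y hx hy]; rewrite vintE ?nabs1 ?nabsB_le//.
by rewrite nabsM// mulr_ile1 ?(nabs_ge0 vP).
Qed.
HB.instance Definition _ :=
  GRing.isSubringClosed.Build F (vint vP) vint_subring.

(** * Limits of sequences and series, and derivatives *)

Lemma abs_cvgP u l : abs_cvg v u l <->
  forall e, 0 < e -> exists N : nat, forall n, (N <= n)%N -> v (u n - l) < e.
Proof.
split=> [/cvgrPdist_lt h e /h[N _ hN]|h].
  by exists N => n /hN /=; rewrite sub0r normrN ger0_norm ?(nabs_ge0 vP).
apply/cvgrPdist_lt => e /h[N hN]; exists N => // n /hN /=.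
by rewrite sub0r normrN ger0_norm ?(nabs_ge0 vP).
Qed.

(** Closed balls are closed. Every estimate on a limit below is obtained by applying this to finite
    approximations. *)
Lemma abs_cvg_le u l M : abs_cvg v u l ->
  (exists N : nat, forall n, (N <= n)%N -> v (u n) <= M) -> v l <= M.
Proof.
move=> /abs_cvgP h [N hN]; apply/ler_addgt0Pr => e e0.
have [N' /(_ (maxn N N') (leq_maxr _ _)) h1] := h e e0.
have -> : l = u (maxn N N') - (u (maxn N N') - l) by rewrite subKr.
have h2 := hN _ (leq_maxl N N').
have M0 : 0 <= M by rewrite (le_trans _ h2)// (nabs_ge0 vP).
apply: nabsB_le; first by rewrite (le_trans h2)// lerDl ltW.
by rewrite (le_trans (ltW h1))// lerDr.
Qed.

Lemma abs_cvg_ext u u' l : u =1 u' -> abs_cvg v u l -> abs_cvg v u' l.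
Proof. by move=> /funext ->. Qed.

Lemma abs_cvg_cst l : abs_cvg v (fun=> l) l.
Proof. by apply/abs_cvgP => e e0; exists 0 => n _; rewrite subrr nabs0. Qed.

Lemma abs_cvgD u u' l l' : abs_cvg v u l -> abs_cvg v u' l' ->
  abs_cvg v (fun n => u n + u' n) (l + l').
Proof.
move=> /abs_cvgP h /abs_cvgP h'; apply/abs_cvgP => e e0.
have [[N hN] [N' hN']] := (h e e0, h' e e0); exists (maxn N N') => n.
rewrite geq_max => /andP[/hN + /hN'] => h1 h2.
by rewrite opprD addrACA nabsD_lt.
Qed.

Lemma abs_cvgMl c u l : abs_cvg v u l -> abs_cvg v (fun n => c * u n) (c * l).
Proof.
move=> /abs_cvgP h; apply/abs_cvgP => e e0.
have [->|c0] := eqVneq c 0.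
  by exists 0 => n _; rewrite !mul0r subrr nabs0.
have vc0 : 0 < v c by rewrite lt_def nabs_neq0 c0 (nabs_ge0 vP).
have [N hN] := h (e / v c) (divr_gt0 e0 vc0); exists N => n /hN.
by rewrite ltr_pdivlMr// -mulrBr nabsM// mulrC.
Qed.

Lemma abs_cvgB u u' l l' : abs_cvg v u l -> abs_cvg v u' l' ->
  abs_cvg v (fun n => u n - u' n) (l - l').
Proof.
move=> hu /(@abs_cvgMl (-1)); rewrite mulN1r => /(abs_cvgD hu).
by apply: abs_cvg_ext => n; rewrite mulN1r.
Qed.

Lemma abs_cvg_sum (I : Type) (r : seq I) (u : I -> nat -> F) (l : I -> F) :
  (forall i, abs_cvg v (u i) (l i)) ->
  abs_cvg v (fun n => \sum_(i <- r) u i n) (\sum_(i <- r) l i).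
Proof.
move=> h; elim: r => [|i r IH].
  by rewrite big_nil; apply: abs_cvg_ext (abs_cvg_cst 0) => n; rewrite big_nil.
rewrite big_cons; apply: abs_cvg_ext (abs_cvgD (h i) IH) => n.
by rewrite big_cons.
Qed.

(** The bounds by 1 keep both cross terms of the product below [e] without rescaling; they hold in
    the application because all coefficients and arguments are integral. *)
Lemma abs_cvgM u u' l l' :
  (forall n, v (u n) <= 1) -> v l' <= 1 ->
  abs_cvg v u l -> abs_cvg v u' l' ->
  abs_cvg v (fun n => u n * u' n) (l * l').
Proof.
move=> u1 l1 /abs_cvgP h /abs_cvgP h'; apply/abs_cvgP => e e0.
have [[N hN] [N' hN']] := (h e e0, h' e e0); exists (maxn N N') => n.
rewrite geq_max => /andP[/hN + /hN'] => h1 h2.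
have -> : u n * u' n - l * l' = u n * (u' n - l') + (u n - l) * l' by ring.
rewrite nabsD_lt// nabsM//.
  by rewrite (le_lt_trans _ h2)// ler_piMl// (nabs_ge0 vP).
by rewrite (le_lt_trans _ h1)// ler_piMr// (nabs_ge0 vP).
Qed.

Lemma abs_cvg_unique u l l' : abs_cvg v u l -> abs_cvg v u l' -> l = l'.
Proof.
move=> hl hl'; apply/eqP; rewrite -subr_eq0 -nabs_neq0 eq_le (nabs_ge0 vP) andbT.
apply: abs_cvg_le (abs_cvgB hl hl') _.
by exists 0 => n _; rewrite subrr nabs0.
Qed.

Lemma abs_cvg_shift m u l : abs_cvg v (fun n => u (m + n)%N) l <-> abs_cvg v u l.
Proof.
split=> /abs_cvgP h; apply/abs_cvgP => e /h[N hN].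
  exists (m + N)%N => n hn; have := hN (n - m)%N; rewrite subnKC; first by apply; lia.
  by lia.
by exists N => n hn; apply: hN; lia.
Qed.

Lemma abs_limE u l : abs_cvg v u l -> abs_lim v u = l.
Proof.
move=> h; rewrite /abs_lim; case: xgetP => [l' _ h'|/(_ l)//].
exact: abs_cvg_unique h' h.
Qed.

Lemma expr_lt (r e : R) : 0 <= r -> r < 1 -> 0 < e ->
  exists N, forall n, (N <= n)%N -> r ^+ n < e.
Proof.
move=> r0 r1 e0; have : `|r| < 1 by rewrite ger0_norm.
move=> /cvg_expr/cvgrPdist_lt/(_ e e0)[N _ hN]; exists N => n /hN /=.
by rewrite sub0r normrN ger0_norm// exprn_ge0.
Qed.

(** By the ultrametric inequality, small consecutive differences already make the sequence
    Cauchy. *)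
Lemma abs_cvg_of_step (u : nat -> F) (r : R) : abs_complete v ->
  0 <= r -> r < 1 -> (forall n, v (u n.+1 - u n) <= r ^+ n) ->
  exists l, abs_cvg v u l.
Proof.
move=> cF r0 r1 h; apply: cF => e /(expr_lt r0 r1)[N hN]; exists N => m n.
suff H k : (N <= k)%N -> v (u k - u N) < e.
  by move=> /H h1 /H h2; rewrite (nabs_dist_lt (y := u N))// nabsC.
have e0 : 0 < e by apply: le_lt_trans (hN N (leqnn _)); rewrite exprn_ge0.
elim: k => [|k IH]; first by rewrite leqn0 => /eqP ->; rewrite subrr nabs0.
rewrite leq_eqVlt => /predU1P[<-|hk]; first by rewrite subrr nabs0.
rewrite (nabs_dist_lt (y := u k)) ?IH//.
by rewrite (le_lt_trans (h k))// hN.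
Qed.

Lemma series_abs_cvg (u : nat -> F) (r : R) : abs_complete v ->
  0 <= r -> r < 1 -> (forall n, v (u n) <= r ^+ n) ->
  exists l, abs_cvg v (series u) l.
Proof.
move=> cF r0 r1 h; apply: (@abs_cvg_of_step _ r) => // n.
by rewrite /series/= big_nat_recr//= addrAC subrr add0r.
Qed.

(** The powers of [t] supply arbitrarily small nonzero increments. For a trivial absolute value
    there would be none, and every [l] would be a derivative; later [t] is [p]. *)
Lemma abs_is_derive_unique f x l l' (t : F) : t != 0 -> v t < 1 ->
  abs_is_derive v f x l -> abs_is_derive v f x l' -> l = l'.
Proof.
move=> t0 t1 h h'; apply/eqP; rewrite -subr_eq0 -nabs_neq0 eq_le (nabs_ge0 vP).
rewrite andbT; apply/ler_addgt0Pr => e e0; rewrite add0r.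
have [[d d0 hd] [d' d0' hd']] := (h e e0, h' e e0).
have dd0 : 0 < Num.min d d' by rewrite lt_min d0.
have [N hN] := expr_lt (nabs_ge0 vP t) t1 dd0.
have := hN N (leqnn _); rewrite -nabsX lt_min => /andP[tN tN'].
have tn0 : t ^+ N != 0 by rewrite expf_neq0.
apply: ltW; rewrite (nabs_dist_lt (y := (f (x + t ^+ N) - f x) / t ^+ N)) ?hd'//.
by rewrite nabsC hd.
Qed.

(** Turns a congruence modulo X^N between integral polynomials into an estimate of their values,
    hence into convergence on the open disc. *)
Lemma nabs_horner_le (P : {poly F}) N x : (forall i, v P`_i <= 1) ->
  (forall i, (i < N)%N -> P`_i = 0) -> v x <= 1 -> v P.[x] <= v x ^+ N.
Proof.
move=> P1 P0 x1; rewrite horner_coef nabs_sum_le// ?exprn_ge0 ?(nabs_ge0 vP)// => i _.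
have [iN|iN] := ltnP i N; first by rewrite P0// mul0r nabs0 exprn_ge0 ?(nabs_ge0 vP).
rewrite nabsM// nabsX -[leRHS]mul1r ler_pM ?exprn_ge0 ?(nabs_ge0 vP)//.
by rewrite ler_wiXn2l ?(nabs_ge0 vP).
Qed.

End Nonarch.

(** * The Artin-Hasse series modulo X^n *)

(** Uniqueness for y' = h y modulo X^N: the equation expresses (i+1) y_(i+1) through the earlier
    coefficients, and i+1 is invertible in the rationals. *)
Lemma eq_coef_ode (h P Q A B : {poly rat}) (N : nat) :
  P^`() = h * P + A * 'X^N -> Q^`() = h * Q + B * 'X^N -> P`_0 = Q`_0 ->
  forall i, (i <= N)%N -> P`_i = Q`_i.
Proof.
move=> eP eQ e0; elim/ltn_ind => -[//|i] IH iN.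
have coef_rec (U D : {poly rat}) : U^`() = h * U + D * 'X^N ->
    U`_i.+1 *+ i.+1 = \sum_(j < i.+1) h`_j * U`_(i - j).
  by move=> /(congr1 (fun p : {poly rat} => p`_i));
     rewrite coef_deriv coefD coefMXn iN addr0 coefM.
apply: (@mulIf _ (i.+1%:R : rat)); first by rewrite pnatr_eq0.
rewrite !mulr_natr (coef_rec _ _ eP) (coef_rec _ _ eQ); apply: eq_bigr => j _.
by rewrite IH//; lia.
Qed.

Definition exp_trunc (N : nat) (L : {poly rat}) : {poly rat} :=
  \sum_(k < N.+1) (k`!%:R)^-1 *: L ^+ k.

(** Differentiation drops the top term of the truncated exponential; since X divides L, the missing
    term L' L^N / N! is a multiple of X^N. *)
Lemma exp_trunc_ode (N : nat) (L L1 : {poly rat}) : L = L1 * 'X ->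
  exists D, (exp_trunc N L)^`() = L^`() * exp_trunc N L + D * 'X^N.
Proof.
move=> eL; exists (- ((N`!%:R)^-1 *: (L^`() * L1 ^+ N))).
have -> : - (N`!%:R^-1 *: (L^`() * L1 ^+ N)) * 'X^N
    = - (L^`() * (N`!%:R^-1 *: L ^+ N)).
  by rewrite {3}eL exprMn -!mul_polyC; ring.
rewrite -mulrBr /exp_trunc [in RHS]big_ord_recr/= addrK big_ord_recl/= expr0.
rewrite fact0 invr1 scale1r derivD -polyC1 derivC add0r raddf_sum/= mulr_sumr.
apply: eq_bigr => k _; rewrite derivZ deriv_exp -scalerAr /bump/= add1n.
rewrite -scaler_nat scalerA factS natrM invfM mulrAC.
by rewrite mulVf; [rewrite div1r add0n|rewrite pnatr_eq0].
Qed.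

Lemma exp_trunc_coef0 N (L : {poly rat}) : L`_0 = 0 -> (exp_trunc N L)`_0 = 1.
Proof.
move=> L0; rewrite /exp_trunc big_ord_recl fact0 invr1 expr0 scale1r coefD.
rewrite coef1 coef_sum big1 ?addr0// => k _.
by rewrite coefZ -horner_coef0 horner_exp horner_coef0 L0 expr0n/= mulr0.
Qed.

Section ArtinHasse.
Variable (p : nat).
Hypothesis p_prime : prime p.

Let p0 : (p%:R : rat) != 0.
Proof. by rewrite pnatr_eq0 -lt0n prime_gt0. Qed.

Lemma ltn_expn_prime n : (n < p ^ n)%N.
Proof. exact/ltn_expl/prime_gt1. Qed.

Definition ah_dlog n : {poly rat} := \sum_(j < n.+1) 'X^(p ^ j - 1).

Lemma deriv_artin_hasse_log n : (artin_hasse_log p n)^`() = ah_dlog n.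
Proof.
rewrite raddf_sum/=; apply: eq_bigr => j _.
rewrite derivZ derivXn -scaler_nat scalerA mulVf ?scale1r ?subn1//.
by rewrite natrX expf_neq0.
Qed.

Lemma artin_hasse_logX n : exists L1, artin_hasse_log p n = L1 * 'X.
Proof.
exists (\sum_(j < n.+1) ((p ^ j)%:R)^-1 *: 'X^(p ^ j - 1)).
rewrite mulr_suml; apply: eq_bigr => j _.
by rewrite -scalerAl -exprSr subn1 prednK// expn_gt0 prime_gt0.
Qed.

Definition ah_poly n := exp_trunc n (artin_hasse_log p n).

Lemma ah_poly_coef0 n : (ah_poly n)`_0 = 1.
Proof.
apply: exp_trunc_coef0; have [L1 ->] := artin_hasse_logX n.
by rewrite coefMX.
Qed.

Lemma ah_dlog_widen m n : (m <= n)%N ->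
  exists D, ah_dlog n = ah_dlog m + D * 'X^m.
Proof.
move=> /subnKC <-; elim: (n - m)%N => [|k [D IH]].
  by exists 0; rewrite addn0 mul0r addr0.
rewrite addnS /ah_dlog big_ord_recr/= -/(ah_dlog _) IH.
exists (D + 'X^(p ^ (m + k).+1 - 1 - m)); rewrite mulrDl addrA -exprD subnK//.
(* An added term has exponent p^j - 1 with j > m, and p^j - 1 >= j. *)
have := ltn_expn_prime (m + k).+1; lia.
Qed.

Lemma ah_poly_ode n :
  exists D, (ah_poly n)^`() = ah_dlog n * ah_poly n + D * 'X^n.
Proof.
have [L1 /exp_trunc_ode] := artin_hasse_logX n => /(_ n) [D].
by rewrite deriv_artin_hasse_log; exists D.
Qed.

(** Both truncations solve the same equation modulo X^m with constant term 1. Thus a single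
    polynomial [ah_poly n] carries all coefficients of E up to degree n. *)
Lemma coef_ah_poly m n : (m <= n)%N -> (ah_poly n)`_m = artin_hasse_coef p m.
Proof.
move=> mn; rewrite -[RHS]/((ah_poly m)`_m).
have [[D eD] [D' eD']] := (ah_poly_ode n, ah_poly_ode m).
have [D'' e] := ah_dlog_widen mn.
apply: (@eq_coef_ode (ah_dlog m) _ _ (D'' * ah_poly n + D * 'X^(n - m)) D' m) => //.
  rewrite eD e -{2}(subnK mn) exprD; ring.
by rewrite !ah_poly_coef0.
Qed.

Lemma ah_poly_expr n i : (i <= n)%N ->
  (ah_poly n ^+ p)`_i = ((ah_poly n \Po 'X^p) * exp_trunc n (p%:R *: 'X))`_i.
Proof.
have [D eD] := ah_poly_ode n.
have [|D1 eE] := @exp_trunc_ode n (p%:R *: 'X) (p%:R%:P); first by rewrite mul_polyC.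
set G := ah_poly n in eD *; set E := exp_trunc _ _ in eE *.
have [M eM] : exists M, 'X^(p ^ n.+1 - 1) = M * 'X^n :> {poly rat}.
  exists 'X^(p ^ n.+1 - 1 - n); rewrite -exprD subnK//.
  by have := ltn_expn_prime n.+1; lia.
(* The functional equation of the logarithmic derivative: (p-1) + p (p^j - 1) = p^(j+1) - 1, so
   substituting X^p shifts the index by one. The truncation leaves one extra top term, the multiple
   [M * 'X^n]. *)
have eH : p%:R *: 'X^(p.-1) * (ah_dlog n \Po 'X^p) + p%:R%:P =
    p%:R *: (ah_dlog n + M * 'X^n).
  rewrite -eM.
  have -> : ah_dlog n + 'X^(p ^ n.+1 - 1) = ah_dlog n.+1.
    by rewrite /ah_dlog [RHS]big_ord_recr.
  rewrite /ah_dlog [in RHS]big_ord_recl/= expn0 subnn expr0 scalerDr addrC.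
  congr (_ + _); first by rewrite -mul_polyC mulr1.
  rewrite -scalerAl; congr (_ *: _); rewrite raddf_sum/= mulr_sumr.
  apply: eq_bigr => j _; rewrite /bump/= add1n comp_Xn_poly -exprM -exprD.
  have pj0 : (0 < p ^ j)%N by rewrite expn_gt0 prime_gt0.
  congr ('X^_); rewrite expnS; move: (prime_gt0 p_prime) pj0.
  by case: (p) (p ^ j)%N => [//|a] [//|b] _ _; rewrite !subn1/=; lia.
(* Cofactors of X^n in the two equations. In [A'] they come from the extra term of [eH], from the
   error of [G] after substituting X^p, and from the truncated exponential. *)
pose A' := p%:R *: (M * ((G \Po 'X^p) * E))
  + p%:R *: ('X^(p.-1) * (D \Po 'X^p) * 'X^(p * n - n) * E)
  + (G \Po 'X^p) * D1.
pose B' := p%:R *: (G ^+ p.-1 * D).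
apply: (@eq_coef_ode (p%:R *: ah_dlog n) _ _ B' A').
- have eGp : G ^+ p = G * G ^+ p.-1 by rewrite -exprS prednK// prime_gt0.
  rewrite deriv_exp eD -scaler_nat /B' eGp -!mul_polyC; ring.
- rewrite derivM deriv_comp eD eE comp_polyD !comp_polyM comp_Xn_poly derivXn.
  rewrite -exprM.
  have -> : (p%:R *: 'X)^`() = p%:R%:P :> {poly rat}.
    by rewrite derivZ derivX alg_polyC.
  have -> : 'X^(p * n) = 'X^(p * n - n) * 'X^n :> {poly rat}.
    by rewrite -exprD subnK// leq_pmull// prime_gt0.
  rewrite -mulr_natl.
  move: eH; rewrite /A' -!mul_polyC -polyC_natr => eH.
  set X1 := 'X^(p.-1) in eH *; set H := _ \Po _ in eH *; set K := _ \Po _.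
  transitivity ((p%:R%:P * X1 * H + p%:R%:P) * (K * E)
     + (p%:R%:P * (X1 * (D \Po 'X^p) * 'X^(p * n - n) * E) + K * D1) * 'X^n).
    ring.
  rewrite eH; ring.
- rewrite coef0M coef_comp_poly_Xn ?prime_gt0// dvdn0 div0n ah_poly_coef0.
  rewrite exp_trunc_coef0 ?coefZ ?coefX ?mulr0// mulr1.
  by rewrite -horner_coef0 horner_exp horner_coef0 ah_poly_coef0 expr1n.
Qed.
End ArtinHasse.

(** * Dwork's integrality theorem *)

(** The inner binomial coefficients are divisible by p, and their quotients by p are natural
    numbers, so [z] stays in the subring. *)
Lemma exprD_prime (T : comNzRingType) (S : subringClosed T) (p : nat) (x y : T) :
  prime p -> x \in S -> y \in S ->
  exists2 z, z \in S & (x + y) ^+ p = x ^+ p + y ^+ p + p%:R * z.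
Proof.
move=> pp xS yS.
exists (\sum_(i < p.-1) ('C(p, i.+1) %/ p)%:R * (x ^+ (p - i.+1) * y ^+ i.+1)).
  by apply: rpred_sum => i _; rewrite !rpredM ?rpredX ?rpred_nat.
rewrite exprDn; case: p pp => [//|q] pp; rewrite big_ord_recl big_ord_recr/=.
rewrite subn0 !expr0 !mulr1 /bump/= add1n subnn binn bin0 !mulr1n mul1r.
rewrite -addrA; congr (_ + _); rewrite addrC; congr (_ + _).
rewrite mulr_sumr; apply: eq_bigr => i _.
rewrite add1n [RHS]mulrA -natrM mulnC divnK ?prime_dvd_bin// ?mulr_natl//.
exact: ltn_ord.
Qed.

Lemma exprD_linear (T : comNzRingType) (x y : T) n :
  exists z, (x + y) ^+ n = x ^+ n + (x ^+ n.-1 * y) *+ n + z * y ^+ 2.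
Proof.
elim: n => [|[|n] [z IH]].
- by exists 0; rewrite !expr0 mulr0n mul0r !addr0.
- by exists 0; rewrite !expr1 expr0 mul1r mul0r addr0.
- exists (x ^+ n *+ n.+1 + z * (x + y)); rewrite exprSr IH /=.
  rewrite -!(mulr_natl (_ * _)) -!(mulr_natl (_ ^+ _)) -[n.+2%:R]natr1 !exprS; ring.
Qed.

(** Legendre's formula gives v_p(n!) = q + v_p(q!) with q the quotient of n by p; by induction this
    is below 2q <= n when q > 0. *)
Lemma logn_fact_lt p n : prime p -> (0 < n)%N -> (logn p n`! < n)%N.
Proof.
move=> pp; elim/ltn_ind: n => n IH n0.
have p1 := prime_gt1 pp.
have e : logn p n`! = (n %/ p + logn p (n %/ p)`!)%N.
  rewrite !logn_fact// big_ltn// expn1; congr addn.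
  have le1 : (1 <= (n %/ p).+1)%N by [].
  have le2 : ((n %/ p).+1 <= n)%N.
    by rewrite ltn_Pdiv.
  rewrite big_add1/= (@big_cat_nat _ _ _ (n %/ p).+1)//=.
  rewrite [X in (_ + X)%N]big_nat_cond [X in (_ + X)%N]big1 ?addn0.
    by apply: eq_bigr => k _; rewrite expnS divnMA.
  move=> k /andP[/andP[h _] _]; rewrite expnS divnMA divn_small//.
  by rewrite (ltn_trans h)// ltn_expl.
have [m0|m0] := posnP (n %/ p); first by rewrite e m0 fact0 logn1.
have lt : (n %/ p < n)%N by rewrite ltn_Pdiv.
have := IH _ lt m0; have := leq_trunc_div n p; nia.
Qed.

Section Integrality.
Variables (R : realType) (v : rat -> R) (p : nat).
Hypothesis vP : nonarch_abs v.
Hypothesis p_prime : prime p.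
Hypothesis vp : v p%:R < 1.

Local Notation S := (vint vP).
Let p0 : (p%:R : rat) != 0.
Proof. by rewrite pnatr_eq0 -lt0n prime_gt0. Qed.

Lemma fermat_int (z : int) : p%:R^-1 * (z%:~R ^+ p - z%:~R) \in S.
Proof.
have nat_case n : p%:R^-1 * (n%:R ^+ p - n%:R) \in S.
  have le : (n <= n ^ p)%N.
    by case: n => // n; rewrite -{1}(expn1 n.+1) leq_pexp2l// prime_gt0.
  have /eqP := fermat_little n p_prime; rewrite eqn_mod_dvd// => /dvdnP[q e].
  by rewrite -natrX -natrB// e natrM mulrC mulfK// rpred_nat.
case: z => n; rewrite ?NegzE ?intrN -pmulrn//.
rewrite exprNn opprK; have [p2|odd_p] := even_prime p_prime; last first.
  rewrite -signr_odd odd_p expr1 mulN1r [X in _ * X]addrC -opprB mulrN.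
  by rewrite rpredN.
(* For p = 2 the sign is lost in the square, and the discrepancy 2m/2 = m is an integer. *)
have -> : p%:R^-1 * ((-1) ^+ p * n.+1%:R ^+ p + n.+1%:R) =
    p%:R^-1 * (n.+1%:R ^+ p - n.+1%:R) + n.+1%:R :> rat.
  by rewrite p2 sqrrN expr1n; field.
by rewrite rpredD// rpred_nat.
Qed.

Lemma fermat_vint (x : rat) : x \in S -> p%:R^-1 * (x ^+ p - x) \in S.
Proof.
move=> xS.
(* If p divided the denominator, the numerator would be prime to p, hence of absolute value 1, and x
   would have absolute value greater than 1. *)
have vden : v (denq x)%:~R = 1.
  have [|pd] := boolP (coprime `|denq x| p); last first.
    have {}pd : (p %| `|denq x|)%N by move: pd; rewrite coprime_sym prime_coprime// negbK.
    have pn : coprime `|numq x| p.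
      rewrite coprime_sym prime_coprime//; apply/negP => pn.
      have := coprime_num_den x; rewrite /coprime => /eqP g1.
      have : (p %| 1)%N by rewrite -g1 dvdn_gcd pn.
      by rewrite dvdn1 => /eqP p1; move: p_prime; rewrite p1.
    have vn : v (numq x)%:~R = 1.
      have := nabs_coprime vP vp pn.
      case: (numq x) => m; rewrite ?NegzE ?mulrNz ?nabsN// ?abszN /=; exact.
    have := xS; rewrite vintE -[x]divq_num_den nabsM// vn mul1r nabsV//.
    have vd : v (denq x)%:~R < 1.
      have : (p%:Z ^+ 1 %| denq x)%Z by rewrite expr1 dvdzE.
      rewrite expr1 => h.
      have := @nabs_dvdz _ _ _ vP p (denq x) 1; rewrite expn1 expr1 => /(_ h).
      by move=> /le_lt_trans; apply.
    rewrite invf_le1 ?leNgt ?vd//.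
    by rewrite lt_def nabs_neq0// intr_eq0 denq_neq0 (nabs_ge0 vP).
  move=> /(nabs_coprime vP vp) <-.
  by rewrite -{1}[denq x]gez0_abs.
have dS : (denq x)%:~R^-1 \in S by rewrite vintE nabsV// vden invr1.
have d0 : (denq x)%:~R != 0 :> rat by rewrite intr_eq0 denq_neq0.
have ex : x = (numq x)%:~R / (denq x)%:~R by rewrite divq_num_den.
have hn := fermat_int (numq x); have hd := fermat_int (denq x).
rewrite [in X in _ * (X ^+ p - _)]ex [in X in _ * (_ - X)]ex.
set a := (numq x)%:~R in hn *; set b := (denq x)%:~R in hd dS d0 *.
(* Writes the Fermat quotient of a fraction as an integral combination of those of its numerator and
   denominator. *)
have -> : p%:R^-1 * ((a / b) ^+ p - a / b) = p%:R^-1 * (a ^+ p - a) * b^-1 ^+ p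
    - p%:R^-1 * (b ^+ p - b) * (a * b^-1 * b^-1 ^+ p).
  rewrite expr_div_n exprVn; field.
  by rewrite p0 d0 expf_neq0.
by rewrite rpredB// rpredM// ?rpredX// rpredM ?rpredX// rpredM// rpred_int.
Qed.

(** Frobenius modulo p, by induction on P X + c: [exprD_prime] separates the two summands, and
    Fermat's theorem treats the constant c. *)
Lemma frobenius_polyOver (P : {poly rat}) : P \is a polyOver S ->
  p%:R^-1 *: (P ^+ p - (P \Po 'X^p)) \is a polyOver S.
Proof.
have XS : 'X \is a polyOver S by rewrite polyOverX.
elim/poly_ind: P => [_|P c IH PcS].
  by rewrite comp_poly0 expr0n gtn_eqF ?prime_gt0// subrr scaler0 rpred0.
have cS : c \in S by have /polyOverP/(_ 0%N) := PcS; rewrite coefD coefMX coefC add0r.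
have PS : P \is a polyOver S.
  apply/polyOverP => i; have /polyOverP/(_ i.+1) := PcS.
  by rewrite coefD coefMX coefC addr0.
have PXS : P * 'X \is a polyOver S by rewrite rpredM.
have cPS : c%:P \is a polyOver S by rewrite polyOverC.
have [Q QS ->] := exprD_prime p_prime PXS cPS.
have -> : p%:R^-1 *: ((P * 'X) ^+ p + c%:P ^+ p + p%:R * Q - ((P * 'X + c%:P) \Po 'X^p))
  = p%:R^-1 *: (P ^+ p - (P \Po 'X^p)) * 'X^p + (p%:R^-1 * (c ^+ p - c))%:P + Q.
  have e : p%:R^-1%:P * p%:R = 1 :> {poly rat} by rewrite -polyC_natr -polyCM mulVf.
  rewrite comp_polyD comp_polyM comp_polyX comp_polyC polyCM polyCB polyC_exp.
  rewrite -!mul_polyC exprMn.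
  transitivity (p%:R^-1%:P * (P ^+ p - (P \Po 'X^p)) * 'X^p
     + p%:R^-1%:P * (c%:P ^+ p - c%:P) + (p%:R^-1%:P * p%:R) * Q); first by ring.
  by rewrite e mul1r.
rewrite !rpredD// ?polyOverC ?fermat_vint//.
by rewrite rpredM ?rpredX// IH.
Qed.

(** This says that exp(pX) = 1 modulo p: the p-part of k! has exponent less than k, and its cofactor
    [m] is a unit. *)
Lemma exp_p_vint k : (0 < k)%N -> p%:R^-1 * ((k`!%:R)^-1 * p%:R ^+ k) \in S.
Proof.
move=> k0; have := logn_fact_lt p_prime k0.
have [m pm e] := pfactor_coprime p_prime (fact_gt0 k).
set l := logn _ _ in e *; move=> lk.
have vm : v m%:R = 1 by apply: nabs_coprime vp _; rewrite // coprime_sym.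
have m0 : m%:R != 0 :> rat by rewrite -(nabs_neq0 vP) vm oner_eq0.
have -> : p%:R^-1 * ((k`!%:R)^-1 * p%:R ^+ k) = m%:R^-1 * p%:R ^+ (k - l.+1) :> rat.
  have -> : p%:R ^+ k = p%:R * p%:R ^+ l * p%:R ^+ (k - l.+1) :> rat.
    by rewrite -exprS -exprD subnKC.
  rewrite e natrM natrX; field.
  by rewrite p0 m0 expf_neq0.
by rewrite rpredM ?rpredX ?rpred_nat// vintE nabsV// vm invr1.
Qed.

(** Strong induction on n. In the X^n coefficient of G^p = G(X^p) exp(pX), the unknown enters only
    as p times itself, on the left; the remaining terms agree modulo p by Frobenius, so dividing by
    p gives an integral expression. *)
Lemma artin_hasse_coef_vint n : artin_hasse_coef p n \in S.
Proof.
elim/ltn_ind: n => n IH.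
have [->|n0] := posnP n.
  by rewrite -(coef_ah_poly p_prime (leqnn 0)) ah_poly_coef0// rpred1.
pose G := ah_poly p n; pose Q := take_poly n G; pose Y := drop_poly n G.
have eG : G = Q + Y * 'X^n by rewrite poly_take_drop.
have QS : Q \is a polyOver S.
  apply/polyOverP => i; rewrite coef_take_poly; case: ifP => [ni|_]; last exact: rpred0.
  by rewrite coef_ah_poly ?IH// ltnW.
have Q0 : Q`_0 = 1 by rewrite coef_take_poly n0 ah_poly_coef0.
have Y0 : Y`_0 = artin_hasse_coef p n by rewrite coef_drop_poly coef_ah_poly.
have ZS := frobenius_polyOver QS.
(* Only the part linear in [Y * 'X^n] counts, as the rest is divisible by X^(2n) and n > 0. *)
have e1 : (G ^+ p)`_n = (Q ^+ p)`_n + p%:R * artin_hasse_coef p n.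
  have [Z] := exprD_linear Q (Y * 'X^n) p; rewrite -eG => ->.
  rewrite !coefD coefMn exprMn -exprM !mulrA !coefMXn ltnn subnn.
  rewrite ifT ?addr0; last by nia.
  rewrite coef0M Y0 -horner_coef0 horner_exp horner_coef0 Q0.
  by rewrite expr1n mul1r mulr_natl.
pose E := exp_trunc n (p%:R *: 'X).
pose E1 : {poly rat} := \sum_(k < n)
  (p%:R^-1 * ((k.+1`!%:R)^-1 * p%:R ^+ k.+1)) *: 'X^(k.+1).
have eE : E = 1 + p%:R *: E1.
  rewrite /E /exp_trunc big_ord_recl/= expr0 fact0 invr1 scale1r; congr (_ + _).
  rewrite scaler_sumr; apply: eq_bigr => k _.
  by rewrite [RHS]scalerA mulVKf// exprZn scalerA.
have E1S : E1 \is a polyOver S.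
  apply: rpred_sum => k _; apply: polyOverZ; first exact: exp_p_vint.
  by rewrite rpredX// polyOverX.
(* Substituting X^p moves the unknown tail to degrees at least pn > n. *)
have e2 : ((G \Po 'X^p) * E)`_n = ((Q \Po 'X^p) * E)`_n.
  rewrite {1}eG comp_polyD comp_polyM comp_Xn_poly -exprM mulrDl coefD.
  rewrite [X in _ + X](_ : _ = 0) ?addr0//.
  rewrite mulrAC coefMXn ifT//; have := prime_gt1 p_prime; nia.
have := ah_poly_expr p_prime (leqnn n); rewrite -/G -/E e1 e2 eE mulrDr mulr1 coefD.
rewrite -scalerAr coefZ => h.
have -> : artin_hasse_coef p n = ((Q \Po 'X^p) * E1)`_n
    - (p%:R^-1 *: (Q ^+ p - (Q \Po 'X^p)))`_n.
  rewrite coefZ coefB.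
  have -> : (Q ^+ p)`_n = (Q \Po 'X^p)`_n + p%:R * ((Q \Po 'X^p) * E1)`_n
     - p%:R * artin_hasse_coef p n by rewrite -h addrK.
  by field.
have QE1S : (Q \Po 'X^p) * E1 \is a polyOver S.
  by rewrite rpredM// polyOver_comp// rpredX// polyOverX.
by apply: rpredB; apply/polyOverP.
Qed.

End Integrality.

(** * The logarithmic derivative of E *)

(** The integrality of [z] bounds the second-order error uniformly over all partial sums of E, so
    that the estimate survives the limit. *)
Lemma horner_taylor2 (F : fieldType) (S : subringClosed F) (P : {poly F}) (x h : F) :
  P \is a polyOver S -> x \in S -> h \in S ->
  exists2 z, z \in S & P.[x + h] = P.[x] + P^`().[x] * h + z * h ^+ 2.
Proof.
move=> + xS hS; elim/poly_ind: P => [_|P c IH PcS].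
  by exists 0; rewrite ?rpred0// deriv0 !horner0 !mul0r !addr0.
have PS : P \is a polyOver S.
  apply/polyOverP => i; have /polyOverP/(_ i.+1) := PcS.
  by rewrite coefD coefMX coefC addr0.
have [z zS e] := IH PS; exists (P^`().[x] + z * (x + h)).
  by rewrite !(rpredD, rpredM)// rpred_horner// polyOver_deriv.
rewrite derivD derivM derivX derivC addr0 mulr1.
by rewrite !(hornerD, hornerM, hornerX, hornerC) e; ring.
Qed.

Section LogDerivative.
Variables (R : realType) (F : fieldType) (v : F -> R) (p : nat).
Variable (phi : {rmorphism rat -> F}).
Hypothesis vP : nonarch_abs v.
Hypothesis v_complete : abs_complete v.
Hypothesis p_prime : prime p.
Hypothesis vp : v p%:R < 1.

Local Notation S := (vint vP).
Let a n : F := ratr (artin_hasse_coef p n).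
Let f x := abs_lim v (series (fun n => a n * x ^+ n)).

(** Pulling the absolute value back to the rationals makes the integrality theorem applicable to the
    rational coefficients of E. *)
Lemma nonarch_abs_comp : nonarch_abs (v \o phi).
Proof.
split=> [x|x|x y|x y] /=; first exact: (nabs_ge0 vP).
- by split=> [/(nabs_eq0 vP)/eqP|->]; rewrite ?fmorph_eq0 ?rmorph0 ?(nabs0 vP)// => /eqP.
- by rewrite rmorphM (nabsM vP).
- by rewrite rmorphD (nabsD vP).
Qed.

Let a_vint n : a n \in S.
Proof.
have vp' : (v \o phi) p%:R < 1 by rewrite /= rmorph_nat.
have := artin_hasse_coef_vint nonarch_abs_comp p_prime vp' n.
by rewrite !vintE /= (fmorph_eq_rat phi).
Qed.

Let P N : {poly F} := \poly_(i < N) a i.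

Let P_vint N : P N \is a polyOver S.
Proof. by apply/polyOverP => i; rewrite coef_poly; case: ifP => // _; rewrite rpred0. Qed.

Let horner_P N x : (P N).[x] = series (fun n => a n * x ^+ n) N.
Proof. by rewrite horner_poly /series /= big_mkord. Qed.

Let f_cvg x : v x < 1 -> abs_cvg v (fun N => (P N).[x]) (f x).
Proof.
move=> x1; have [|l hl] := @series_abs_cvg _ _ _ vP (fun n => a n * x ^+ n) _
    v_complete (nabs_ge0 vP x) x1.
  move=> n; rewrite nabsM// nabsX// ler_piMl ?exprn_ge0 ?(nabs_ge0 vP)//.
  by have := a_vint n; rewrite vintE.
rewrite /f (abs_limE vP hl); apply: abs_cvg_ext hl => N.
by rewrite horner_P.
Qed.

Let a0 : a 0%N = 1.
Proof.
rewrite /a -(coef_ah_poly p_prime (leqnn 0)) ah_poly_coef0//.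
by rewrite -(fmorph_eq_rat phi) rmorph1.
Qed.

(** The partial sums have constant term 1 and integral coefficients, so they differ from 1 by at
    most |x|; a zero of E would give 1 <= |x|. *)
Let f_neq0 x : v x < 1 -> f x != 0.
Proof.
move=> x1; apply/eqP => fx0.
have := abs_cvgB vP (f_cvg x1) (abs_cvg_cst vP 1); rewrite fx0 sub0r.
move=> h; suff : (1 : R) <= v x by rewrite leNgt x1.
rewrite -(nabs1 vP) -(nabsN vP); apply: (abs_cvg_le vP h).
exists 1%N => N N0; rewrite -(hornerC 1 x) -hornerN -hornerD -[leRHS]expr1.
apply: nabs_horner_le => // [i|i|]; last exact: ltW.
  have /polyOverP/(_ i) : P N - 1%:P \is a polyOver S.
    by rewrite rpredB// polyOverC rpred1.
  by rewrite vintE.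
by rewrite ltnS leqn0 => /eqP ->; rewrite coefB coef_poly N0 coefC eqxx a0 subrr.
Qed.

Let G N : {poly F} := \sum_(j < N.+1) 'X^(p ^ j - 1).

Let horner_G N x : (G N).[x] = series (fun n => x ^+ (p ^ n - 1)) N.+1.
Proof.
rewrite /series /= big_mkord horner_sum; apply: eq_bigr => i _.
by rewrite hornerXn.
Qed.

Let G_vint N : G N \is a polyOver S.
Proof. by apply: rpred_sum => j _; rewrite rpredX// polyOverX. Qed.

(** The index [N.+1] is needed because the derivative at degree i < N involves the coefficient of
    degree i+1 <= N. *)
Let P_ode N i : (i < N)%N -> ((P N.+1)^`() - G N * P N.+1)`_i = 0.
Proof.
move=> iN; have [D] := ah_poly_ode p_prime N.
move=> /(congr1 (fun q : {poly rat} => phi q`_i)) /=; rewrite coefD coefMXn iN addr0.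
have eG : G N = map_poly phi (ah_dlog p N).
  by rewrite rmorph_sum; apply: eq_bigr => j _; rewrite /= map_polyXn.
have eP k : (k <= N)%N -> (P N.+1)`_k = phi (ah_poly p N)`_k.
  by move=> kN; rewrite coef_poly ltnS kN coef_ah_poly// (fmorph_eq_rat phi).
rewrite coefB !coef_deriv !coefM rmorphMn rmorph_sum eP// => ->.
apply/eqP; rewrite subr_eq0; apply/eqP/eq_bigr => j _.
by rewrite rmorphM eG coef_map eP//; lia.
Qed.

Lemma artin_hasse_is_derive x l : v x < 1 ->
  abs_cvg v (series (fun n => x ^+ (p ^ n - 1))) l ->
  abs_is_derive v f x (l * f x).
Proof.
move=> x1 hl.
(* The derivatives of the partial sums converge to the expected value: they differ from
   [G N * P N.+1] by an integral polynomial vanishing below degree N. *)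
have P'_cvg : abs_cvg v (fun N => (P N.+1)^`().[x]) (l * f x).
  have hG : abs_cvg v (fun N => (G N).[x]) l.
    apply: abs_cvg_ext (_ : abs_cvg v (fun N => series _ (1 + N)%N) l) => [N|].
      by rewrite horner_G add1n.
    exact/abs_cvg_shift.
  have hP : abs_cvg v (fun N => (P N.+1).[x]) (f x).
    have := (abs_cvg_shift vP 1 _ _).2 (f_cvg x1).
    by apply: abs_cvg_ext => N; rewrite add1n.
  have xS : x \in S by rewrite vintE ltW.
  have fx1 : v (f x) <= 1.
    apply: abs_cvg_le hP _ => //; exists 0 => N _; rewrite -(vintE vP).
    exact: rpred_horner.
  have G1 N : v (G N).[x] <= 1 by rewrite -(vintE vP) rpred_horner.
  have h0 : abs_cvg v (fun N => ((P N.+1)^`() - G N * P N.+1).[x]) 0.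
    apply/abs_cvgP => // e e0; have [N hN] := expr_lt (nabs_ge0 vP x) x1 e0.
    exists N => n Nn; rewrite subr0; apply: le_lt_trans (hN n Nn).
    apply: nabs_horner_le => //; [move=> i|exact: P_ode].
    have /polyOverP/(_ i) : (P n.+1)^`() - G n * P n.+1 \is a polyOver S.
      by rewrite rpredB ?rpredM// polyOver_deriv.
    by rewrite vintE.
  have := abs_cvgD vP h0 (abs_cvgM vP G1 fx1 hG hP); rewrite add0r.
  by apply: abs_cvg_ext => N; rewrite hornerD hornerN hornerM subrK.
(* The bound 1 keeps x + h in the disc; the error of the difference quotient is then at most |h|,
   uniformly in the partial sum. *)
move=> e e0; exists (Num.min 1 e); first by rewrite lt_min ltr01.
move=> h h0; rewrite lt_min => /andP[h1 he]; refine (le_lt_trans _ he).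
have xh1 : v (x + h) < 1 by rewrite nabsD_lt.
have := abs_cvgB vP (f_cvg xh1) (f_cvg x1) => /(abs_cvgMl vP h^-1).
move=> /(abs_cvg_shift vP 1 _ _).2 /(abs_cvgB vP)/(_ P'_cvg).
rewrite mulrC => /(abs_cvg_le vP); apply; exists 0 => N _.
have [z zS e1] := horner_taylor2 (P_vint N.+1) (ltW x1 : x \in S) (ltW h1 : h \in S).
rewrite add1n e1.
have -> : h^-1 * ((P N.+1).[x] + (P N.+1)^`().[x] * h + z * h ^+ 2 - (P N.+1).[x])
   - (P N.+1)^`().[x] = z * h by field.
by rewrite nabsM// ler_piMl ?(nabs_ge0 vP).
Qed.

Lemma log_derive_artin_hasse x : v x < 1 ->
  abs_cvg v (series (fun n => x ^+ (p ^ n - 1))) (log_derive v f x).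
Proof.
move=> x1.
have [|l hl] := @series_abs_cvg _ _ _ vP (fun n => x ^+ (p ^ n - 1)) _
    v_complete (nabs_ge0 vP x) x1.
  move=> n; rewrite nabsX// ler_wiXn2l ?(nabs_ge0 vP) ?ltW//.
  by have := ltn_expn_prime p_prime n; lia.
have hd := artin_hasse_is_derive x1 hl.
have p0 : p%:R != 0 :> F.
  by rewrite -(rmorph_nat phi) fmorph_eq0 pnatr_eq0 -lt0n prime_gt0.
have ed : abs_derive v f x = l * f x.
  rewrite /abs_derive; case: xgetP => [l' _ h'|/(_ (l * f x))//].
  exact: (abs_is_derive_unique vP p0 vp h' hd).
by rewrite /log_derive ed mulfK ?f_neq0.
Qed.

End LogDerivative.

(** * A Jacobsthal-type congruence *)

Section Combinatorics.
Local Open Scope nat_scope.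

Lemma big_nat_dvdn (T : Type) (idx : T) (op : Monoid.com_law idx) (p m : nat)
    (E : nat -> T) : (0 < p)%N -> (0 < m)%N ->
  \big[op/idx]_(1 <= i < p * m | p %| i) E i = \big[op/idx]_(1 <= j < m) E (p * j)%N.
Proof.
move=> p0; elim: m => [//|[_ _|m IH _]].
  rewrite muln1 [RHS]big_geq// big_nat_cond big1// => i /andP[/andP[i1 ip]].
  by rewrite gtnNdvd.
rewrite [RHS]big_nat_recr//= -IH// mulnS addnC.
(* The new block of length p contains a single multiple of p, namely its first index. *)
rewrite (@big_cat_nat _ _ _ (p * m.+1))//= ?leq_addr ?muln_gt0 ?p0//; congr (op _ _).
rewrite big_ltn_cond; last by rewrite -{1}[(p * _)%N]addn0 ltn_add2l.
rewrite dvdn_mulr// big_nat_cond big1 ?Monoid.mulm1// => i.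
move=> /andP[/andP[h1 h2] /dvdnP[q e]]; move: h1 h2; rewrite e.
by have [h|h] := leqP q m.+1 => h1 h2; exfalso; nia.
Qed.

Section BinomialCongruence.
Variables (p a b : nat).
Hypothesis p_prime : prime p.
Hypothesis b_gt0 : (0 < b)%N.
Hypothesis b_le : (b <= a)%N.

Let num := (\prod_(1 <= i < p * b | ~~ (p %| i)) (p * a - i))%N.
Let den := (\prod_(1 <= i < p * b | ~~ (p %| i)) i)%N.

(** C(pa-1, pb-1) is the product of (pa-i)/i for 1 <= i < pb. The factors with p dividing i give
    C(a-1, b-1) after cancelling p; the others give num/den. *)
Let fact_split :
  (('C(p * a - 1, p * b - 1) * den) = num * 'C(a - 1, b - 1))%N.
Proof.
have p0 := prime_gt0 p_prime.
have binE m k : (0 < k)%N -> (k <= m)%N ->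
    ('C(m - 1, k - 1) * \prod_(1 <= i < k) i = \prod_(1 <= i < k) (m - i))%N.
  move=> k0 km; have := bin_ffact (m - 1) (k - 1).
  rewrite fact_prod ffact_prod (_ : (k - 1).+1 = k); last by lia.
  by move=> ->; rewrite big_add1 -subn1 big_mkord; apply: eq_bigr => i _; lia.
have pb0 : (0 < p * b)%N by rewrite muln_gt0 p0.
have := binE (p * a)%N (p * b)%N pb0 _; rewrite leq_mul2l b_le orbT => /(_ isT).
rewrite (bigID (dvdn p))/= [in RHS](bigID (dvdn p))/= -/num -/den.
rewrite !big_nat_dvdn// big_split/=.
have -> : (\prod_(1 <= j < b) (p * a - p * j) =
           \prod_(1 <= j < b) p * \prod_(1 <= j < b) (a - j))%N.
  by rewrite -big_split/=; apply: eq_bigr => j _; rewrite mulnBr.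
rewrite -(binE a b)// => e.
have k0 : (0 < \prod_(1 <= j < b) p * \prod_(1 <= j < b) j)%N.
  rewrite muln_gt0 prodn_gt0//= big_nat_cond prodn_cond_gt0// => i.
  by case/andP => /andP[].
apply/eqP; rewrite -(eqn_pmul2l k0); apply/eqP; move: e. nia.
Qed.

(** Reflecting i to pb - i makes [num] comparable with [den] factor by factor, both in size and
    modulo p. *)
Let num_rev : num = (\prod_(1 <= i < p * b | ~~ (p %| i)) (p * (a - b) + i))%N.
Proof.
rewrite /num big_nat_rev/= big_nat_cond [RHS]big_nat_cond.
apply: eq_big => [i|i /andP[/andP[i1 i2] _]]; last first.
  have hab : p * b <= p * a by rewrite leq_mul2l b_le orbT.
  by rewrite mulnBr; lia.
case: (ltnP 0 i) => //= i1; case: (ltnP i (p * b)) => //= i2.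
by rewrite add1n subSS dvdn_subr// ?dvdn_mulr// ltnW.
Qed.

Let eqmod_prod (M : nat) (E G : nat -> nat) (P : pred nat) m n :
  (forall i, (m <= i < n)%N -> P i -> E i = G i %[mod M]) ->
  (\prod_(m <= i < n | P i) E i = \prod_(m <= i < n | P i) G i %[mod M])%N.
Proof.
move=> h; rewrite big_nat_cond [in RHS]big_nat_cond.
elim/big_rec2: _ => // i x y /andP[mi Pi] e.
by rewrite -modnMm (h _ mi Pi) e modnMm.
Qed.

(** Pairing i with pb - i cancels the first-order term: (p(a-b)+i)(pa-i) = (a-b) p^2 a + i(pb-i). *)
Let num_sqr : num ^ 2 = den ^ 2 %[mod p * (p * a)].
Proof.
have -> : (num ^ 2 = \prod_(1 <= i < p * b | ~~ (p %| i))
    ((p * (a - b) + i) * (p * a - i)))%N.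
  by rewrite big_split/= -num_rev expnS expn1.
have -> : (den ^ 2 = \prod_(1 <= i < p * b | ~~ (p %| i)) (i * (p * b - i)))%N.
  rewrite big_split/= expnS expn1; congr muln.
  rewrite /den big_nat_rev/= big_nat_cond [RHS]big_nat_cond.
  apply: eq_big => [i|i /andP[/andP[i1 i2] _]]; last by lia.
  case: (ltnP 0 i) => //= i1; case: (ltnP i (p * b)) => //= i2.
  by rewrite add1n subSS dvdn_subr// ?dvdn_mulr// ltnW.
apply: eqmod_prod => i /andP[i1 i2] _.
have -> : ((p * (a - b) + i) * (p * a - i) =
    (a - b) * (p * (p * a)) + i * (p * b - i))%N.
  have -> : a = ((a - b) + b)%N by rewrite subnK.
  rewrite addnK; set c := (a - b)%N.
  have -> : (p * (c + b) - i = p * c + (p * b - i))%N by rewrite mulnDr; lia.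
  have := subnKC (ltnW i2); set d := (p * b - i)%N => e.
  have -> : (p * (p * (c + b)) = p * (p * c + (i + d)))%N by rewrite e mulnDr.
  by nia.
by rewrite modnMDl.
Qed.

Let coprime_den : coprime p den.
Proof.
rewrite /den; elim/big_rec: _ => [|i x pi cx]; first exact: coprimen1.
by rewrite coprimeMr prime_coprime// pi.
Qed.

(** Ensures that the subtraction of natural numbers in the congruence below is not truncated. *)
Lemma leq_bin_pmul : ('C(a - 1, b - 1) <= 'C(p * a - 1, p * b - 1))%N.
Proof.
have den0 : (0 < den)%N.
  by rewrite /den big_nat_cond prodn_cond_gt0// => i /andP[/andP[]].
rewrite -(leq_pmul2r den0) fact_split mulnC leq_mul2r; apply/orP; right.
by rewrite num_rev /den; apply: leq_prod => i _; rewrite leq_addl.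
Qed.

(* Reversing [i |-> p b - i] shows [num ^ 2 = den ^ 2] modulo [p ^ 2 a] and
   [num = den] modulo [p]; [num + den] is then a unit modulo [p]. *)
Lemma dvdn_bin_pmul s : odd p -> a = (p ^ s)%N ->
  (p ^ s.+2 %| 'C(p * a - 1, p * b - 1) - 'C(a - 1, b - 1))%N.
Proof.
move=> p_odd ea.
have le_den : (den <= num)%N.
  by rewrite num_rev /den; apply: leq_prod => i _; rewrite leq_addl.
have eM : (p * (p * a) = p ^ s.+2)%N by rewrite !expnS ea.
have num_mod : num = den %[mod p].
  rewrite num_rev; apply: eqmod_prod => i _ _.
  by rewrite mulnC modnMDl.
have cop : coprime (p ^ s.+2) (num + den).
  rewrite coprimeXl// prime_coprime//; apply/negP => h.
  have : (p %| 2 * den)%N.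
    by rewrite /dvdn mul2n -addnn -modnDml -num_mod modnDml.
  rewrite Euclid_dvdM// => /orP[|].
    by rewrite dvdn_prime2// => /eqP p2; move: p_odd; rewrite p2.
  by apply/negP; rewrite -prime_coprime.
have h1 : (p ^ s.+2 %| num - den)%N.
  rewrite -(Gauss_dvdl _ cop) -subn_sqr -eqn_mod_dvd ?leq_sqr//.
  by rewrite -eM; apply/eqP; exact: num_sqr.
have cop' : coprime (p ^ s.+2) den by rewrite coprimeXl.
by rewrite -(Gauss_dvdl _ cop') mulnBl fact_split [X in _ - X]mulnC -mulnBl dvdn_mulr.
Qed.

End BinomialCongruence.
End Combinatorics.

(** * Roots of unity and arc sums *)

(** The order of z is a power p^e with e <= n+1, and e <= n is excluded by the second condition. *)
Lemma prim_root_prime_pow (K : nzRingType) (p n : nat) (z : K) : prime p ->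
  z ^+ (p ^ n.+1) = 1 -> z ^+ (p ^ n) != 1 -> (p ^ n.+1).-primitive_root z.
Proof.
move=> pp z1 zn1; have N0 : (0 < p ^ n.+1)%N by rewrite expn_gt0 prime_gt0.
have [m mz /(dvdn_pfactor _ _ pp)[e le em]] := prim_order_exists N0 z1.
suff ne : (n < e)%N.
  have <- : e = n.+1 by lia.
  by rewrite -em.
rewrite ltnNge; apply: contra zn1 => en.
by rewrite -(prim_order_dvd mz) em dvdn_exp2l.
Qed.

Lemma closed_field_prim_root (K : fieldType) (p n : nat) :
  GRing.closed_field_axiom K -> prime p -> (p%:R : K) != 0 ->
  exists z : K, (p ^ n).-primitive_root z.
Proof.
move=> cK pp p0; have p1 := prime_gt1 pp.
case: n => [|n].
  have [m m1 /[!dvdn1]/eqP e] := prim_order_exists (leqnn 1) (expr1n K 1).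
  by exists 1; rewrite expn0 -[X in X.-primitive_root]e.
suff [z z1 zn1] : exists2 z : K, z ^+ (p ^ n.+1) = 1 & z ^+ (p ^ n) != 1.
  by exists z; apply: prim_root_prime_pow.
elim: n => [|n [y y1 yn1]].
  (* A root of 1 + X + ... + X^(p-1); it is not 1, since the value at 1 is p. *)
  have [|x ex] := cK p.-1 (fun=> -1); first by rewrite -subn1 subn_gt0.
  have s0 : \sum_(i < p) x ^+ i = 0.
    rewrite -(big_mkord xpredT (fun i => x ^+ i)) -{1}(prednK (ltnW p1)).
    rewrite big_nat_recr//= ex big_mkord -big_split big1// => i _.
    by rewrite mulN1r; exact: subrr.
  exists x; first by apply/eqP; rewrite expn1 -subr_eq0 subrX1 s0 mulr0.
  rewrite expn0 expr1; apply: contra_neq p0 => x1.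
  move: s0; rewrite x1 (eq_bigr (fun=> 1)) => [|i _]; last by rewrite expr1n.
  by rewrite sumr_const card_ord.
(* A p-th root of the previous root of unity. *)
have [|z ez] := cK p (fun i => if i == 0%N then y else 0); first exact: ltnW.
have {}ez : z ^+ p = y.
  rewrite ez -(big_mkord xpredT (fun i => (if i == 0%N then y else 0) * z ^+ i)).
  rewrite big_ltn ?(ltnW p1)// expr0 mulr1 big_nat big1 ?addr0// => i.
  by case: i => // i _; rewrite mul0r.
by exists z; rewrite expnS exprM ez.
Qed.

Section ArcSum.
Variables (R : realType) (F : fieldType) (v : F -> R) (p : nat).
Hypothesis vP : nonarch_abs v.
Hypothesis p_prime : prime p.
Hypothesis p_odd : odd p.
Hypothesis vp : v p%:R < 1.
Hypothesis p_neq0 : (p%:R : F) != 0.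

Local Notation S := (vint vP).

(** The number T(n,j): the normalized sum of z (1-z)^(p^j-1) over the p^n-th roots of unity z. The
    index l is the exponent of z, shifted by one by the factor z. *)
Definition arc_coef (n j : nat) : F :=
  \sum_(1 <= l < (p ^ j).+1 | (p ^ n %| l)%N) (-1) ^+ l.-1 * 'C(p ^ j - 1, l.-1)%:R.

Lemma sum_prim_root N (w : F) m : N.-primitive_root w ->
  \sum_(i < N) (w ^+ i) ^+ m = if (N %| m)%N then N%:R else 0.
Proof.
move=> wN; rewrite (prim_order_dvd wN).
rewrite (eq_bigr (fun i : 'I_N => (w ^+ m) ^+ i)); last first.
  by move=> i _; rewrite -!exprM mulnC.
have [->|wm] := eqVneq (w ^+ m) 1.
  by rewrite (eq_bigr (fun=> 1)) ?sumr_const ?card_ord// => i _; rewrite expr1n.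
have /eqP := subrX1 (w ^+ m) N.
rewrite -exprM mulnC exprM (prim_expr_order wN) expr1n subrr eq_sym mulf_eq0.
by rewrite subr_eq0 (negPf wm)/= => /eqP.
Qed.

Lemma arc_coefE n j (w : F) : (p ^ n).-primitive_root w ->
  ((p ^ n)%:R)^-1 * (\sum_(i < p ^ n) w ^+ i * (1 - w ^+ i) ^+ (p ^ j - 1)) =
  arc_coef n j.
Proof.
move=> wN; have pn0 : (p ^ n)%:R != 0 :> F by rewrite natrX expf_neq0.
have pj0 : (p ^ j - 1).+1 = (p ^ j)%N by rewrite subn1 prednK// expn_gt0 prime_gt0.
have -> : arc_coef n j = \sum_(l < (p ^ j - 1).+1)
    if (p ^ n %| l.+1)%N then (-1) ^+ l * 'C(p ^ j - 1, l)%:R else 0.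
  by rewrite /arc_coef -{1}pj0 big_add1/= big_mkcond big_mkord.
under eq_bigr => i _ do rewrite exprBn mulr_sumr.
rewrite exchange_big/= mulr_sumr.
apply: eq_bigr => l _; rewrite /=.
under eq_bigr => i _ do
  rewrite expr1n mulr1 mulrnAr mulrCA -exprS -mulrnAl -mulr_natr.
rewrite -mulr_sumr (sum_prim_root _ wN); case: ifP => _; last by rewrite !mulr0.
by rewrite mulrCA mulVf// mulr1.
Qed.

Lemma arc_coef_lt n j : (j < n)%N -> arc_coef n j = 0.
Proof.
move=> jn; rewrite /arc_coef big_nat_cond big1// => l /andP[/andP[l0 lj] /(dvdn_leq l0)].
have : (p ^ j < p ^ n)%N by rewrite ltn_exp2l// prime_gt1.
by move: lj; rewrite ltnS; lia.
Qed.

(** Only l = p^n contributes, with sign +1 because p^n - 1 is even. *)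
Lemma arc_coefnn n : arc_coef n n = 1.
Proof.
have pn0 : (0 < p ^ n)%N by rewrite expn_gt0 prime_gt0.
rewrite /arc_coef big_mkcond/= big_nat_recr//= dvdnn big_nat big1 ?add0r.
  by rewrite subn1 binn mulr1 -signr_odd -subn1 oddB// oddX p_odd orbT.
by move=> l /andP[l0 ln]; rewrite gtnNdvd.
Qed.

(** The only root of unity involved is 1, and 1 - 1 is raised to the positive power p^j - 1. *)
Lemma arc_coef0 j : (0 < j)%N -> arc_coef 0 j = 0.
Proof.
move=> j0; have w1 : (p ^ 0).-primitive_root (1 : F).
  have [m m1 /[!dvdn1]/eqP e] := prim_order_exists (leqnn 1) (expr1n F 1).
  by rewrite expn0 -[X in X.-primitive_root]e.
rewrite -(arc_coefE _ w1) expn0 big_ord1 expr0 subrr expr0n.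
have : (1 < p ^ j)%N by rewrite -(expn0 p) ltn_exp2l// prime_gt1.
by case: (p ^ j)%N => [|[|q]]// _; rewrite !mulr0.
Qed.

Lemma arc_coefSS n j : v (arc_coef n.+1 j.+1 - arc_coef n j) <= v p%:R ^+ j.+2.
Proof.
have p0 := prime_gt0 p_prime.
have pj0 : (0 < p ^ j)%N by rewrite expn_gt0 prime_gt0.
have -> : arc_coef n.+1 j.+1 = \sum_(1 <= l < (p ^ j).+1 | (p ^ n %| l)%N)
    (-1) ^+ l.-1 * 'C(p * p ^ j - 1, (p * l).-1)%:R.
  rewrite /arc_coef expnS.
  (* The range is enlarged to end at a multiple of p, so that l = p l' can be substituted; the added
     binomial coefficients are 0. *)
  transitivity (\sum_(1 <= l < p * (p ^ j).+1 | (p %| l)%N)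
     if (p ^ n.+1 %| l)%N then (-1) ^+ l.-1 * 'C(p * p ^ j - 1, l.-1)%:R else 0 : F).
    rewrite -big_mkcondr/= [RHS](@big_cat_nat _ _ _ (p * p ^ j).+1)//=; last first.
      by rewrite mulnS; lia.
    rewrite [X in _ = _ + X]big_nat_cond [X in _ = _ + X]big1 ?addr0.
      apply: eq_bigl => l; rewrite andb_idl// => /(dvdn_trans _); apply.
      by rewrite expnS dvdn_mulr.
    move=> l /andP[/andP[l1 _] _]; rewrite bin_small ?mulr0//.
    have ppj0 : (0 < p * p ^ j)%N by rewrite muln_gt0 p0.
    by move: l1; case: l => //= l; lia.
  rewrite big_nat_dvdn// [RHS]big_mkcond/= big_nat_cond [RHS]big_nat_cond.
  apply: eq_bigr => l /andP[/andP[l0 _] _]; rewrite expnS dvdn_pmul2l//.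
  case: ifP => // _; congr (_ * _); rewrite -signr_odd -[RHS]signr_odd.
  congr (_ ^+ (nat_of_bool _)); rewrite -!subn1 !oddB ?muln_gt0 ?p0//.
  by rewrite oddM p_odd.
rewrite -sumrB big_nat_cond; apply: nabs_sum_le => // [|l].
  by rewrite exprn_ge0// (nabs_ge0 vP).
move=> /andP[/andP[l0 lj] _]; rewrite -mulrBr nabsM// nabsX// nabsN// nabs1//.
rewrite expr1n mul1r -!subn1 -natrB ?leq_bin_pmul//.
have h := dvdn_bin_pmul p_prime l0 (lj : (l <= p ^ j)%N) p_odd erefl.
exact: (nabs_dvdz vP (z := Posz _) h).
Qed.

Lemma nabs_root_unity n (z : F) : z ^+ (p ^ n) = 1 -> v z = 1.
Proof.
move=> z1; apply/eqP; rewrite -(@pexpr_eq1 _ _ (p ^ n)) ?(nabs_ge0 vP)//.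
  by rewrite -nabsX// z1 nabs1.
by rewrite expn_gt0 prime_gt0.
Qed.

(** The points 1 - z at which E'/E is evaluated lie in the open disc: (1-z)^p = 1 - z^p modulo p,
    and z^p has smaller order exponent. *)
Lemma nabs_1Broot n (z : F) : z ^+ (p ^ n) = 1 -> v (1 - z) < 1.
Proof.
elim: n z => [|n IH] z zn.
  by move: zn; rewrite expn0 expr1 => ->; rewrite subrr nabs0.
have zS : - z \in S by rewrite rpredN vintE (nabs_root_unity zn).
have S1 : 1 \in S by exact: rpred1.
have [q qS e] := exprD_prime p_prime S1 zS.
have : v ((1 - z) ^+ p) < 1.
  rewrite e expr1n exprNn -signr_odd p_odd expr1 mulN1r nabsD_lt ?IH//.
    by rewrite -exprM -expnS.
  by rewrite nabsM// (le_lt_trans _ vp)// ler_piMr ?(nabs_ge0 vP).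
by rewrite nabsX// expr_lt1 ?prime_gt0 ?(nabs_ge0 vP).
Qed.

(** * Convergence of the arc sums and value of the limit modulo p^3 *)

Variable g : F -> F.
Hypothesis gP : forall x, v x < 1 ->
  abs_cvg v (series (fun n => x ^+ (p ^ n - 1))) (g x).
Hypothesis root_ex : forall n, exists w : F, (p ^ n).-primitive_root w.

(** With a = 1 and b = 0 the points are x = 1 - z and x - a = -z, whence the sign. The sum over z is
    finite, so it commutes with the limit of the series. *)
Lemma arc_sum_cvg n :
  abs_cvg v (fun J => - \sum_(j < J) arc_coef n j) (arc_sum p 1 0 g n).
Proof.
have [w wN] := root_ex n.
have wi1 i : (w ^+ i) ^+ (p ^ n) = 1.
  by rewrite -exprM mulnC exprM (prim_expr_order wN) expr1n.
have -> : arc_sum p 1 0 g n =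
    - ((p ^ n)%:R^-1 * \sum_(i < p ^ n) w ^+ i * g (1 - w ^+ i)).
  rewrite /arc_sum -mulrN -sumrN; congr (_ * _).
  have us : uniq [seq w ^+ i | i : 'I_(p ^ n)].
    rewrite map_inj_uniq ?enum_uniq// => i j /eqP.
    by rewrite (eq_prim_root_expr wN) !modn_small// => /eqP/val_inj.
  have -> : [set z : F | z ^+ (p ^ n) = 1] = [set` [seq w ^+ i | i : 'I_(p ^ n)]].
    apply/seteqP; split => z /= => [/(prim_rootP wN)[i ->]|/mapP[i _ ->]//].
    by apply: map_f; rewrite mem_enum.
  rewrite -fsbig_seq// big_image/=; apply: eq_bigr => i _.
  by rewrite sub0r mulN1r addrAC subrr add0r mulNr.
rewrite -mulN1r.
have : abs_cvg v (fun J => -1 * ((p ^ n)%:R^-1 * \sum_(i < p ^ n) w ^+ i *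
    series (fun j => (1 - w ^+ i) ^+ (p ^ j - 1)) J))
  (-1 * ((p ^ n)%:R^-1 * \sum_(i < p ^ n) w ^+ i * g (1 - w ^+ i))).
  apply: abs_cvgMl => //; apply: abs_cvgMl => //; apply: abs_cvg_sum => // i.
  by apply: abs_cvgMl => //; apply: gP; exact: nabs_1Broot (wi1 i).
apply: abs_cvg_ext => J; rewrite mulN1r; congr (- _).
under [RHS]eq_bigr => j _ do rewrite -(arc_coefE j wN).
rewrite -mulr_sumr exchange_big/=; congr (_ * _); apply: eq_bigr => i _.
by rewrite -mulr_sumr /series/= big_mkord.
Qed.

Lemma arc_sumS n : v (arc_sum p 1 0 g n.+1 - arc_sum p 1 0 g n) <= v p%:R ^+ (n + 3).
Proof.
have h := abs_cvgB vP ((abs_cvg_shift vP 1 _ _).2 (arc_sum_cvg n.+1)) (arc_sum_cvg n).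
apply: (abs_cvg_le vP h); exists 0%N => J _.
(* The sum for n+1 is taken one term longer; its first term vanishes, and T(n+1,j+1) is paired with
   T(n,j). The pairs with j <= n cancel exactly, so the first error occurs at j = n+1 and is at most
   |p|^(n+3). *)
rewrite add1n big_ord_recl arc_coef_lt// add0r opprK addrC -sumrB.
apply: nabs_sum_le => // [|j _]; first by rewrite exprn_ge0// (nabs_ge0 vP).
rewrite lift0.
have [jn|nj] := leqP j n.
  move: jn; rewrite leq_eqVlt => /predU1P[->|jn].
    by rewrite !arc_coefnn subrr nabs0// exprn_ge0// (nabs_ge0 vP).
  by rewrite !arc_coef_lt// subrr nabs0// exprn_ge0// (nabs_ge0 vP).
rewrite nabsC//; apply: le_trans (arc_coefSS n j) _.
by rewrite ler_wiXn2l ?(nabs_ge0 vP) ?ltW//; lia.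
Qed.

Lemma arc_sum0 : arc_sum p 1 0 g 0 = -1.
Proof.
apply: (abs_cvg_unique vP) (arc_sum_cvg 0) _; apply/(abs_cvg_shift vP 1).
apply: abs_cvg_ext (abs_cvg_cst vP (-1)) => J.
rewrite add1n big_ord_recl arc_coefnn big1 ?addr0// => j _.
by rewrite arc_coef0.
Qed.

Lemma arc_integral_ex : abs_complete v -> exists I, is_arc_integral v p 1 0 g I /\
  v (I + 1) <= v p%:R ^+ 3.
Proof.
move=> v_complete.
have [|I hI] := abs_cvg_of_step vP v_complete (nabs_ge0 vP p%:R) vp
    (u := arc_sum p 1 0 g).
  move=> n; apply: le_trans (arc_sumS n) _.
  by rewrite ler_wiXn2l ?(nabs_ge0 vP) ?ltW// leq_addr.
exists I; split=> //.
apply: (abs_cvg_le vP (abs_cvgD vP hI (abs_cvg_cst vP 1))); exists 0%N => n _.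
(* Every arc sum is within |p|^3 of -1, since the 0-th equals -1 and each step is at most |p|^3. *)
elim: n => [|n IH].
  by rewrite arc_sum0 addNr nabs0// exprn_ge0// (nabs_ge0 vP).
rewrite -(subrK (arc_sum p 1 0 g n) (arc_sum p 1 0 g n.+1)) -addrA nabsD_le//.
apply: le_trans (arc_sumS n) _.
by rewrite ler_wiXn2l ?(nabs_ge0 vP) ?ltW// leq_addl.
Qed.

End ArcSum.

Theorem theorem4p18 (R : realType) (p : nat) (p_prime : prime p)
    (p_odd : odd p) (C : Cp R p) :
  (forall x : C, Cp_abs x < 1 ->
     abs_cvg (@Cp_abs R p C) (series (fun n : nat => x ^+ (p ^ n - 1)))
       (log_derive (@Cp_abs R p C) (@artin_hasse R p C) x)) /\
  (exists I : C,
     is_arc_integral (@Cp_abs R p C) p 1 0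
       (log_derive (@Cp_abs R p C) (@artin_hasse R p C)) I /\
     Cp_abs (I + 1) <= p%:R ^- 3).
Proof.
pose v := @Cp_abs R p C.
have vP : nonarch_abs v := completion_abs (Cp_completion C).
have v_complete := completion_complete (Cp_completion C).
pose phi1 : {rmorphism rat -> Qpbar C} := (@Qpbar_of_Qp R p C \o @Qp_of_rat R p C).
pose phi : {rmorphism rat -> C} := (@Cp_of_Qpbar R p C \o phi1).
have p0 := prime_gt0 p_prime; have p1 := prime_gt1 p_prime.
(* The normalization is traced down the tower to the explicit p-adic absolute value on the
   rationals. *)
have vpE : v p%:R = p%:R^-1.
  rewrite -(rmorph_nat phi) /v /phi /= (completion_ext (Cp_completion C)).
  rewrite Qpbar_ext (completion_ext (Qp_completion C)) /padic_abs.
  have -> : (p%:R : rat) = (p%:Z)%:~R by [].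
  rewrite intr_eq0 gt_eqF// numq_int denq_int logn1 expr0.
  by rewrite logn_prime// eqxx expr1 div1r.
have vp : v p%:R < 1 by rewrite vpE invf_lt1 ?ltr1n ?ltr0n.
have pK0 : p%:R != 0 :> Qpbar C.
  by rewrite -(rmorph_nat phi1) fmorph_eq0 pnatr_eq0 -lt0n.
have pC0 : p%:R != 0 :> C by rewrite -(rmorph_nat (@Cp_of_Qpbar R p C)) fmorph_eq0.
have gP := log_derive_artin_hasse phi vP v_complete p_prime vp.
split; first exact: gP.
(* Roots of unity are found in the algebraic closure of Q_p and carried into C_p by the embedding,
   which preserves their order. *)
have root_ex n : exists w : C, (p ^ n).-primitive_root w.
  have [z zn] := closed_field_prim_root n
    (algclosure_closed (Qpbar_closure C)) p_prime pK0.
  by exists (@Cp_of_Qpbar R p C z); rewrite fmorph_primitive_root.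
have [I [hI hI1]] := arc_integral_ex vP p_prime p_odd vp pC0 gP root_ex v_complete.
by exists I; split=> //; rewrite -exprVn -vpE.
Qed.
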